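(* Assume $q_{0,2}\neq 0$ and $q_{1,2}\neq 0$, let $m\in\mathbb N$ and $\rho=\dfrac{q_{0,1}q_{1,1}}{q_{0,2}q_{1,2}}$. The state probabilities of the random walk on the hexagonal lattice started at the origin satisfy the following at even times. (i) For $0\le j\le m$ and $-m\le k\le 0$, $$p_{j,k}(2m)=\sum_{t=0}^{m-j}\binom{m}{t}\binom{m}{j+t}\binom{j+t}{-k}\,q_{0,0}^{m-t}\,q_{1,0}^{m-j-t}\,q_{0,2}^{t}\,q_{1,2}^{j+k+t}\,q_{1,1}^{-k}\ {}_2F_1(-j-k-t,-t;1-k;\rho).$$ (ii) For $0\le j\le m$ and $1\le k\le m-j$, $$p_{j,k}(2m)=\sum_{t=k}^{m-j}\binom{m}{t}\binom{m}{j+t}\binom{t}{k}\,q_{0,0}^{m-t}\,q_{1,0}^{m-j-t}\,q_{0,1}^{k}\,q_{0,2}^{-k+t}\,q_{1,2}^{j+t}\ {}_2F_1(-j-t,k-t;1+k;\rho).$$ (iii) For $-m\le j\le -1$ and $-m-j\le k\le -1$, $$p_{j,k}(2m)=\sum_{t=-k}^{m+j}\binom{m}{t}\binom{m}{-j+t}\binom{t}{-k}\,q_{0,0}^{m+j-t}\,q_{1,0}^{m-t}\,q_{0,2}^{-j+t}\,q_{1,2}^{k+t}\,q_{1,1}^{-k}\ {}_2F_1(j-t,-k-t;1-k;\rho).$$ (iv) For $-m\le j\le -1$ and $0\le k\le m$, $$p_{j,k}(2m)=\sum_{t=0}^{m+j}\binom{m}{t}\binom{m}{-j+t}\binom{-j+t}{k}\,q_{0,0}^{m+j-t}\,q_{1,0}^{m-t}\,q_{0,1}^{k}\,q_{0,2}^{-j-k+t}\,q_{1,2}^{t}\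 {}_2F_1(j+k-t,-t;1+k;\rho).$$
   Context: Fix $a>0$ and nonnegative numbers $q_{i,r}$ ($i=0,1$; $r=0,1,2$) with $\sum_{r=0}^2 q_{i,r}=1$ for $i=0,1$. The vertices of the hexagonal lattice are $\mathscr V_0\cup\mathscr V_1$, where $$\mathscr V_i=\left\{\left(\tfrac32 aj+ia,\ \tfrac{\sqrt3}{2}aj+\sqrt3 ak\right): j,k\in\mathbb Z\right\},\quad i=0,1.$$ $\{(X_n,Y_n):n\in\mathbb N_0\}$ is the time-homogeneous Markov chain on $\mathscr V_0\cup\mathscr V_1$ which, from a vertex $(x,y)\in\mathscr V_i$, moves in one step to $\left(x+a\cos(\tfrac{2\pi r}{3}+i\pi),\ y+a\sin(\tfrac{2\pi r}{3}+i\pi)\right)$ with probability $q_{i,r}$, $r=0,1,2$ (such a point belongs to $\mathscr V_{1-i}$). The initial condition is $(X_0,Y_0)=(0,0)$ almost surely. For $n\in\mathbb N_0$ and $j,k\in\mathbb Z$, $$p_{j,k}(n)=\mathbb P\left[(X_n,Y_n)=\left(\tfrac32 aj+i_na,\ \tfrac{\sqrt3}{2}aj+\sqrt3ak\right)\right],\qquad i_n=\tfrac12(1-(-1)^n).$$ The Gauss hypergeometric function is ${}_2F_1(\alpha,\beta;\gamma;z)=\sum_{n=0}^{\infty}\frac{(\alpha)_n(\beta)_n}{(\gamma)_n}\frac{z^n}{n!}$, with $(\alpha)_0=1$ and $(\alpha)_n=\alpha(\alpha+1)\cdots(\alpha+n-1)$ for $n\in\mathbb N$; in every use here the series terminates.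 Conventions: $0^0=1$, and $\binom{p}{q}=0$ for integers $q>p\ge0$. *)

(* Defs.v *)
From HB Require Import structures.
From mathcomp Require Import all_boot all_order all_algebra.
From mathcomp Require Import all_classical all_reals all_analysis.

Set Implicit Arguments.
Unset Strict Implicit.
Unset Printing Implicit Defensive.

Import Order.TTheory GRing.Theory Num.Theory.
Import numFieldNormedType.Exports.

Local Open Scope classical_set_scope.
Local Open Scope ring_scope.

Section special_functions.
Context {R : realType}.
Implicit Types (x y c z : R).

Definition pochhammer x (n : nat) : R := \prod_(0 <= l < n) (x + l%:R).

Definition hyp2F1 x y c z : R :=
  limn (series (fun n : nat =>
    pochhammer x n * pochhammer y n / pochhammer c n * (z ^+ n / n`!%:R))).

(* Junk value 0 when an argument is negative; 0 <= p < q also gives 0. *)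
Definition binz (p q : int) : R :=
  match p, q with
  | Posz p', Posz q' => 'C(p', q')%:R
  | _, _ => 0
  end.

End special_functions.

Section lattice.
Context {R : realType}.
Implicit Types (a x y : R).

Definition vertex a (i : R) (j k : int) : R * R :=
  (3 / 2 * a * j%:~R + i * a,
   Num.sqrt 3 / 2 * a * j%:~R + Num.sqrt 3 * a * k%:~R).

Definition vertices a (i : 'I_2) : set (R * R) :=
  [set v | exists j k : int, v = vertex a i%:R j k].

Definition neighbour a (i : 'I_2) (r : 'I_3) (v : R * R) : R * R :=
  (v.1 + a * cos (2 * pi * r%:R / 3 + i%:R * pi),
   v.2 + a * sin (2 * pi * r%:R / 3 + i%:R * pi)).

End lattice.

Section process.
Context {R : realType} {d : measure_display} {T : measurableType d}.
Variable P : probability T R.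

(* Only meaningful when P B != 0. *)
Definition cond_prob (A B : set T) : R := fine (P (A `&` B)) / fine (P B).

Definition markov_property (S : Type) (Z : nat -> T -> S) : Prop :=
  forall (n : nat) (z : nat -> S),
    let past := [set w | forall l : nat, (l <= n)%N -> Z l w = z l] in
    P past != 0%E ->
    cond_prob [set w | Z n.+1 w = z n.+1] past =
    cond_prob [set w | Z n.+1 w = z n.+1] [set w | Z n w = z n].

(* [hexagonal_step] determines the whole transition kernel, because the three
   neighbours of a vertex are distinct and the q i r sum to 1 over r. *)
Record hexagonal_walk (a : R) (q : 'I_2 -> 'I_3 -> R)
    (X Y : nat -> {RV P >-> R}) : Prop := HexagonalWalk {
  hexagonal_state : forall (n : nat) (w : T),
    (vertices a 0 `|` vertices a 1) (X n w, Y n w) ;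
  hexagonal_markov : markov_property (fun n w => (X n w, Y n w)) ;
  hexagonal_step : forall (n : nat) (i : 'I_2) (r : 'I_3) (v : R * R),
    vertices a i v ->
    P [set w | (X n w, Y n w) = v] != 0%E ->
    cond_prob [set w | (X n.+1 w, Y n.+1 w) = neighbour a i r v]
              [set w | (X n w, Y n w) = v] = q i r ;
  hexagonal_init : {ae P, forall w, (X 0%N w, Y 0%N w) = (0, 0)}
}.

Definition state_prob (a : R) (X Y : nat -> {RV P >-> R})
    (j k : int) (n : nat) : R :=
  let i_n := (1 - (-1) ^+ n) / 2 in
  fine (P [set w | (X n w, Y n w) = vertex a i_n j k]).

End process.

(* Main.v *)
Require Import Defs.
From HB Require Import structures.
From mathcomp Require Import all_boot all_order all_algebra.
From mathcomp Require Import all_classical all_reals all_analysis.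
From mathcomp Require Import ring lra zify.

(* In lattice coordinates (j, k) a step from V_0 adds (0,0), (-1,1) or (-1,0),
   and a step from V_1 adds (0,0), (1,-1) or (1,0). Shifting each step so that
   exponents stay nonnegative, two steps have generating function
   (q00 u + q01 v + q02) (q10 v + u (q11 + q12 v)), and p_{j,k}(2m) is the
   coefficient of u^(m+j) v^(m+k) in its m-th power. Expanding first in u and
   then in v gives a double binomial sum whose inner sum is a terminating 2F1.

   That the coefficients are the probabilities needs only one-step
   conditioning: the mass at a vertex is at least the mass arriving from its
   three neighbours, so by induction the probabilities dominate the
   coefficients; the coefficients add up to 1, hence equality. *)

Import Order.TTheory GRing.Theory Num.Theory.
Import numFieldNormedType.Exports.

Set Implicit Arguments.
Unset Strict Implicit.
Unset Printing Implicit Defensive.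

Local Open Scope ring_scope.

(** * Coefficients of a product of powers of two linear polynomials *)

(** Lets the range of a binomial sum be moved freely once the binomials vanish. *)
Lemma sum_ord_trunc (V : nmodType) (f : nat -> V) m n :
  (forall i, (m <= i)%N -> f i = 0) -> (forall i, (n <= i)%N -> f i = 0) ->
  \sum_(i < m) f i = \sum_(i < n) f i.
Proof.
wlog le_mn : m n / (m <= n)%N.
  move=> th fm fn; have [/th|/ltnW/th] := leqP m n; first exact.
  by move=> ->.
move=> fm _; rewrite (big_ord_widen _ _ le_mn) big_mkcond /=.
apply: eq_bigr => i _; case: ltnP => // /fm -> //.
Qed.

Section linear_powers.
Variables (A : comNzRingType) (x y z w : A).

Let term (m n i s : nat) : A :=
  'C(m, i)%:R * 'C(n, s)%:R * x ^+ (m - i) * y ^+ i * z ^+ (n - s) * w ^+ s.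

Lemma coef_linear_powers m n N :
  ((x *: 'X + y%:P) ^+ m * (z%:P + w *: 'X) ^+ n)`_N =
  \sum_(i < m.+1) \sum_(s < n.+1 | (m - i + s == N)%N) term m n i s.
Proof.
rewrite !exprDn mulr_suml coef_sum; apply: eq_bigr => i _.
rewrite mulr_sumr coef_sum [RHS]big_mkcond /=; apply: eq_bigr => s _.
rewrite !exprZn -!polyC_exp.
have -> : (x ^+ (m - i) *: 'X^(m - i) * (y ^+ i)%:P) *+ 'C(m, i) *
    (((z ^+ (n - s))%:P * (w ^+ s *: 'X^s)) *+ 'C(n, s)) =
    term m n i s *: 'X^(m - i + s).
  rewrite mulrnAl mulrnAr -mulrnA -[LHS]mulr_natr natrM -!mul_polyC /term.
  by rewrite exprD !polyCM !polyC_natr; ring.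
by rewrite coefZ coefXn eq_sym; case: eqP => _; rewrite ?mulr1 ?mulr0.
Qed.

(** For [i <= m] the condition [m - i + s = m + k] forces [s = k + i], so one index remains. The
    bound [B] is free because, from [B] on, one of the two binomials is 0. *)
Lemma coef_linear_powers_ge m n k B : (n < k + B \/ m < B)%N ->
  ((x *: 'X + y%:P) ^+ m * (z%:P + w *: 'X) ^+ n)`_(m + k) =
  \sum_(0 <= i < B)
    'C(m, i)%:R * 'C(n, k + i)%:R * x ^+ (m - i) * y ^+ i
    * z ^+ (n - (k + i)) * w ^+ (k + i).
Proof.
move=> ltB; rewrite coef_linear_powers big_mkord.
rewrite -[RHS](@sum_ord_trunc _ (fun i => term m n i (k + i)) m.+1 B).
- apply: eq_bigr => -[i /= lti] _.
  rewrite (eq_bigl (fun s : 'I__ => s == k + i :> nat)%N); last first.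
    by move=> s; apply/eqP/eqP; lia.
  rewrite big_ord1_eq; case: ltnP => // ?.
  by rewrite /term (@bin_small n) ?mulr0 ?mul0r.
- by move=> i ?; rewrite /term bin_small ?mul0r.
- move=> i ?; rewrite /term; case: ltB => ltB.
    by rewrite (@bin_small n) ?mulr0 ?mul0r//; lia.
  by rewrite bin_small ?mul0r//; lia.
Qed.

(** Below the degree [m] the index to eliminate is the other one: [m - i + s = m - k] forces
    [i = k + s]. *)
Lemma coef_linear_powers_le m n k B : (k <= m)%N -> (m < k + B \/ n < B)%N ->
  ((x *: 'X + y%:P) ^+ m * (z%:P + w *: 'X) ^+ n)`_(m - k) =
  \sum_(0 <= s < B)
    'C(m, k + s)%:R * 'C(n, s)%:R * x ^+ (m - (k + s)) * y ^+ (k + s)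
    * z ^+ (n - s) * w ^+ s.
Proof.
move=> lekm ltB; rewrite coef_linear_powers big_mkord.
rewrite (exchange_big_dep xpredT) //=.
rewrite -[RHS](@sum_ord_trunc _ (fun s => term m n (k + s) s) n.+1 B).
- apply: eq_bigr => -[s /= lts] _.
  have [lekm'|] := leqP (k + s) m.
    rewrite (eq_bigl (fun i : 'I__ => i == k + s :> nat)%N); last first.
      by move=> [i lti] /=; apply/eqP/eqP; lia.
    by rewrite (@big_ord1_eq _ _ _ (fun i => term m n i s)) ltnS lekm'.
  (* If [k + s] exceeds [m], no [i] in range meets the condition, and the term is 0 as well. *)
  move=> gtm; have -> : term m n (k + s) s = 0 by rewrite /term bin_small ?mul0r.
  rewrite big1// => -[i lti] /= /eqP; lia.
- by move=> i ?; rewrite /term (@bin_small n) ?mulr0 ?mul0r.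
- move=> i ?; rewrite /term; case: ltB => ltB.
    by rewrite bin_small ?mul0r//; lia.
  by rewrite (@bin_small n) ?mulr0 ?mul0r//; lia.
Qed.

End linear_powers.

(** * Terminating hypergeometric sums *)

Lemma ffactD n k l : (n ^_ (k + l) = n ^_ k * (n - k) ^_ l)%N.
Proof.
elim: l => [|l IH]; first by rewrite addn0 muln1.
by rewrite addnS !ffactnSr IH subnDA mulnA.
Qed.

Section hypergeometric.
Variable R : realType.

Lemma pochhammer_opp N n :
  pochhammer (- N%:R : R) n = (-1) ^+ n * (N ^_ n)%:R.
Proof.
rewrite /pochhammer; elim: n => [|n IH]; first by rewrite big_nil expr0 mul1r.
rewrite big_nat_recr //= IH ffactnSr natrM exprS.
(* The subtraction [N - n] agrees with the one in [R] only for [n <= N]; beyond that both products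
   already contain the factor 0. *)
have [len|/ffact_small ->] := leqP n N; last by rewrite !(mulr0, mul0r).
by rewrite natrB //; ring.
Qed.

Lemma pochhammer_fact k n :
  pochhammer (1 + k%:R : R) n * k`!%:R = (k + n)`!%:R.
Proof.
rewrite /pochhammer; elim: n => [|n IH]; first by rewrite big_nil addn0 mul1r.
rewrite big_nat_recr //= mulrAC IH addnS factS natrM -natr1 natrD; ring.
Qed.

(** The signs of the two upper Pochhammer symbols cancel, and [l!] turns one falling factorial into
    a binomial. That binomial vanishes for [l > n], so the partial sums are eventually constant and
    the limit is a finite sum. *)
Lemma hyp2F1_terminating N n k (z : R) :
  hyp2F1 (- N%:R) (- n%:R) (1 + k%:R) z =
  \sum_(0 <= l < n.+1) (N ^_ l)%:R * 'C(n, l)%:R * k`!%:R / (k + l)`!%:R * z ^+ l.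
Proof.
have factN0 l : l`!%:R != 0 :> R by rewrite pnatr_eq0 -lt0n fact_gt0.
have termE l : pochhammer (- N%:R : R) l * pochhammer (- n%:R) l /
    pochhammer (1 + k%:R) l * (z ^+ l / l`!%:R) =
    (N ^_ l)%:R * 'C(n, l)%:R * k`!%:R / (k + l)`!%:R * z ^+ l.
  rewrite !pochhammer_opp -pochhammer_fact -(bin_ffact n l) natrM.
  have sq : (-1) ^+ l * (-1) ^+ l = 1 :> R.
    by rewrite -expr2 sqrr_sign.
  have p0 : pochhammer (1 + k%:R : R) l != 0.
    have := factN0 (k + l)%N; rewrite -pochhammer_fact mulf_eq0.
    by rewrite negb_or => /andP[].
  transitivity (((-1) ^+ l * (-1) ^+ l) * (N ^_ l)%:R * 'C(n, l)%:R *
      (l`!%:R / l`!%:R) / pochhammer (1 + k%:R) l * z ^+ l); first by ring.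
  by rewrite sq divff // mul1r mulr1; field; rewrite p0 factN0.
apply/cvg_lim; first exact: norm_hausdorff.
apply: cvg_near_cst; near=> p.
rewrite /series /= (eq_bigr _ (fun l _ => termE l)).
have len : (n < p)%N by near: p; exact: nbhs_infty_gt.
rewrite (@big_cat_nat _ _ _ n.+1) //= [X in _ + X]big1_seq ?addr0 // => l.
rewrite mem_index_iota => /andP[_ /andP[ltl _]].
by rewrite (@bin_small n) // !(mulr0, mul0r).
Unshelve. all: by end_near. Qed.

(** Factoring out the summand at [l = 0] leaves the ratio [(s - k) ^_ l * k! / (k + l)!] of
    binomials, which is the hypergeometric weight. The powers of [x] and [z] drop by [l], which is
    why these two are inverted in the argument. *)
Lemma sum_bin_hyp2F1 (x y z w : R) s t k : (k <= s)%N -> x != 0 -> z != 0 ->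
  \sum_(0 <= l < t.+1)
    'C(s, k + l)%:R * 'C(t, l)%:R * x ^+ (s - (k + l)) * y ^+ (k + l)
    * z ^+ (t - l) * w ^+ l =
  'C(s, k)%:R * x ^+ (s - k) * y ^+ k * z ^+ t *
  hyp2F1 (- (s - k)%:R) (- t%:R) (1 + k%:R) (w * y / (x * z)).
Proof.
move=> leks x0 z0; rewrite hyp2F1_terminating mulr_sumr.
apply: eq_big_nat => l /andP[_ ltl].
have [lel|ltl'] := leqP (k + l) s; last first.
  rewrite bin_small // ffact_small; last by lia.
  by rewrite !(mulr0, mul0r).
have xE : x ^+ (s - k) = x ^+ (s - (k + l)) * x ^+ l.
  by rewrite -exprD; congr (_ ^+ _); lia.
have zE : z ^+ t = z ^+ (t - l) * z ^+ l.
  by rewrite -exprD; congr (_ ^+ _); lia.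
have binE : 'C(s, k + l)%:R =
    'C(s, k)%:R * ((s - k) ^_ l)%:R * k`!%:R / (k + l)`!%:R :> R.
  have f0 : (k + l)`!%:R != 0 :> R by rewrite pnatr_eq0 -lt0n fact_gt0.
  apply: (mulIf f0); rewrite divfK // -!natrM bin_ffact ffactD.
  by rewrite mulnAC bin_ffact.
rewrite binE xE zE exprD !exprMn exprVn exprMn.
have fx : x ^+ l != 0 by rewrite expf_neq0.
have fz : z ^+ l != 0 by rewrite expf_neq0.
have f0 : (k + l)`!%:R != 0 :> R by rewrite pnatr_eq0 -lt0n fact_gt0.
by field; rewrite f0 fx fz.
Qed.

End hypergeometric.

(** * The hexagonal lattice in integer coordinates *)

Section geometry.
Variable R : realType.

Lemma cos_sin_2pi3 : cos (2 * pi / 3) = - 1 / 2 :> R /\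
  sin (2 * pi / 3) = Num.sqrt 3 / 2 :> R.
Proof.
set x : R := 2 * pi / 3.
have pi0 : 0 < pi :> R by exact: pi_gt0.
have xb : 0 < x < pi by rewrite /x; apply/andP; split; lra.
have c0 : cos x < 0.
  rewrite -[ltRHS](cos_pihalf R) ltr_cos ?in_itv /= /x; lra.
have s0 : 0 < sin x by exact: sin_gt0_pi.
have E := cos2Dsin2 x.
(* sin (3 x) = sin x * (4 (cos x)^2 - 1) vanishes while sin x > 0. *)
have s3 : sin (x + x *+ 2) = 0.
  by rewrite -[RHS](sin2pi R); congr sin; rewrite /x; lra.
move: s3; rewrite sinD sin_mulr2n cos_mulr2n => s3.
have : sin x * (4 * cos x ^+ 2 - 1) = 0 by rewrite -[RHS]s3; ring.
move/eqP; rewrite mulf_eq0 (gt_eqF s0) /= => /eqP c2.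
have /eqP : (2 * cos x - 1) * (2 * cos x + 1) = 0 by rewrite -[RHS]c2; ring.
(* The root 1/2 is excluded because the cosine is negative; the sine then follows from its square,
   being positive. *)
rewrite mulf_eq0 => /orP[/eqP ?|/eqP c1]; first lra.
have cE : cos x = - 1 / 2 by lra.
split=> //; apply: (pexpIrn (n := 2)) => //; rewrite ?nnegrE ?divr_ge0 ?sqrtr_ge0 ?ltW //.
rewrite expr_div_n sqr_sqrtr //; move: E; rewrite cE; lra.
Qed.

Lemma cos_sin_4pi3 : cos (2 * pi * 2 / 3) = - 1 / 2 :> R /\
  sin (2 * pi * 2 / 3) = - (Num.sqrt 3 / 2) :> R.
Proof.
have [c s] := cos_sin_2pi3.
have -> : 2 * pi * 2 / 3 = (2 * pi / 3) *+ 2 :> R by rewrite mulr2n; lra.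
by rewrite cos_mulr2n sin_mulr2n c s; split; field.
Qed.

(** Replaces the trigonometric step by an integer shift, which can be compared with a monomial. *)
Lemma neighbour0_vertex (a : R) (j k : int) (r : 'I_3) :
  neighbour a 0 r (vertex a 0 j k) =
  vertex a 1 (j - (r != 0)%:Z) (k + (r == 1)%:Z).
Proof.
have [c1 s1] := cos_sin_2pi3; have [c2 s2] := cos_sin_4pi3.
rewrite /neighbour /vertex /= mul0r.
case: r => -[|[|[|//]]] i3; rewrite -!val_eqE /= ?mulr1n ?mulr0 ?mulr1 ?mul0r ?addr0.
- by rewrite cos0 sin0 ?subr0 ?addr0; congr (_, _); field.
- by rewrite c1 s1 ?subr0 ?addr0 ?intrD ?intrB; congr (_, _); field.
- by rewrite c2 s2 ?subr0 ?addr0 ?intrD ?intrB; congr (_, _); field.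
Qed.

Lemma neighbour1_vertex (a : R) (j k : int) (r : 'I_3) :
  neighbour a 1 r (vertex a 1 j k) =
  vertex a 0 (j + (r != 0)%:Z) (k - (r == 1)%:Z).
Proof.
have [c1 s1] := cos_sin_2pi3; have [c2 s2] := cos_sin_4pi3.
rewrite /neighbour /vertex /= ?mulr1n !mul1r !(cosDpi, sinDpi).
case: r => -[|[|[|//]]] i3; rewrite -!val_eqE /= ?mulr1n ?mulr0 ?mulr1 ?mul0r ?addr0.
- by rewrite cos0 sin0 ?subr0 ?addr0; congr (_, _); field.
- by rewrite c1 s1 ?subr0 ?addr0 ?intrD ?intrB; congr (_, _); field.
- by rewrite c2 s2 ?subr0 ?addr0 ?intrD ?intrB; congr (_, _); field.
Qed.

(** With [i] fixed, the abscissa determines [j], and the ordinate then determines [k]. *)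
Lemma vertex_inj (a i : R) (j k j' k' : int) : a != 0 ->
  vertex a i j k = vertex a i j' k' -> j = j' /\ k = k'.
Proof.
move=> a0 [/addIr ej].
have {ej}-> : j = j'.
  apply: (@intr_inj R); apply: mulfI ej.
  by rewrite !mulf_neq0 ?invr_eq0 ?pnatr_eq0.
move/addrI/mulfI => ek; split=> //; apply: (@intr_inj R); apply: ek.
by rewrite mulf_neq0 // gt_eqF // sqrtr_gt0.
Qed.

End geometry.

(** * Total mass of disjoint events *)

Section probability_lemmas.
Context {R : realType} {d : measure_display} {T : measurableType d}.
Variable P : probability T R.

(** Additivity followed by monotonicity. It serves twice: for the three ways of reaching a vertex,
    and for the positions on a finite grid. *)
Lemma sum_fine_probability_le (I : finType) (F : I -> set T) (B : set T) :
  (forall i, measurable (F i)) -> measurable B ->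
  (forall i, F i `<=` B)%classic -> trivIset setT F ->
  \sum_i fine (P (F i)) <= fine (P B).
Proof.
move=> mF mB FB tF.
have fin A : measurable A -> P A \is a fin_num by exact: fin_num_measure.
have finI : finite_set [set` enum I] by exact: finite_seq.
have UB : (\bigcup_(i in [set` enum I]) F i `<=` B)%classic.
  by move=> w [i _]; exact: FB.
have mU : measurable (\bigcup_(i in [set` enum I]) F i)%classic.
  exact: fin_bigcup_measurable.
rewrite -lee_fin fineK ?fin // (le_trans _ (le_measure P _ _ UB)) ?inE //.
rewrite measure_fin_bigcup //; last exact: sub_trivIset tF.
rewrite -fsbig_seq ?enum_uniq // big_enum /= -EFin_sum_fine => [|i _]; last exact: fin.
by [].
Qed.

End probability_lemmas.

(** * Generating polynomials of a single step *)

Section generating_function.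
Context {R : realType}.
Variable q : 'I_2 -> 'I_3 -> R.

(** The outer variable records [j] and the inner one [k]. Both polynomials are written as linear in
    the outer variable, so that [coef_linear_powers] applies over [{poly R}]. This one shifts the
    exponent of [j] by 1, while [down_gen] shifts that of [k]. *)
Definition up_gen : {poly {poly R}} :=
  (q 0 0)%:P *: 'X + ((q 0 2)%:P + q 0 1 *: 'X)%:P.
Definition down_gen : {poly {poly R}} :=
  (q 1 0 *: 'X)%:P + (q 1 2 *: 'X + (q 1 1)%:P) *: 'X.

(** This recursion and the one for [down_gen] have their terms in the order of [prob_step0] and
    [prob_step1]; an index that would become negative contributes 0. *)
Lemma coef_up_gen (G : {poly {poly R}}) J K :
  (up_gen * G)`_J`_K =
  q 0 0 * (if J is J'.+1 then G`_J'`_K else 0)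
  + q 0 1 * (if K is K'.+1 then G`_J`_K' else 0) + q 0 2 * G`_J`_K.
Proof.
rewrite mulrDl -scalerAl coefD coefZ coefXM coefCM mulrDl coefD coefCM.
rewrite coefD coefCM -scalerAl coefZ coefXM.
by case: J K => [|J] [|K] /=; rewrite ?coef0; ring.
Qed.

Lemma coef_down_gen (G : {poly {poly R}}) J K :
  (down_gen * G)`_J`_K =
  q 1 0 * (if K is K'.+1 then G`_J`_K' else 0)
  + q 1 1 * (if J is J'.+1 then G`_J'`_K else 0)
  + q 1 2 * (if J is J'.+1 then if K is K'.+1 then G`_J'`_K' else 0 else 0).
Proof.
rewrite mulrDl -scalerAl coefD coefZ coefXM coefCM.
rewrite coefD -scalerAl coefZ coefXM mulrDl coefD coefCM -scalerAl coefZ coefXM.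
by case: J K => [|J] [|K] /=; rewrite ?coef0; ring.
Qed.

Lemma sum_coef_horner (G : {poly {poly R}}) N :
  (size G <= N)%N -> (forall J, size (G`_J)%R <= N)%N ->
  \sum_(J < N) \sum_(K < N) G`_J`_K = G.[1].[1].
Proof.
move=> sG sGJ; rewrite (horner_coef_wide _ sG) horner_sum.
apply: eq_bigr => J _; rewrite expr1n mulr1 (horner_coef_wide _ (sGJ J)).
by apply: eq_bigr => K _; rewrite expr1n mulr1.
Qed.

End generating_function.

(** * Law of the walk at even times *)

Lemma sum_ord3 (V : nmodType) (f : 'I_3 -> V) :
  \sum_(r < 3) f r = f 0 + f 1 + f 2.
Proof.
rewrite !big_ord_recl big_ord0 addr0 addrA.
by congr (_ + f _ + f _); exact: val_inj.
Qed.

Section walk_distribution.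
Context {R : realType} {d : measure_display} {T : measurableType d}.
Variable P : probability T R.
Variables (a : R) (q : 'I_2 -> 'I_3 -> R) (X Y : nat -> {RV P >-> R}).
Hypotheses (a_gt0 : 0 < a) (q_ge0 : forall i r, 0 <= q i r).
Hypothesis (q_sum1 : forall i, \sum_(r < 3) q i r = 1).
Hypothesis (walk : hexagonal_walk a q X Y).

Let at_ n v := [set w | (X n w, Y n w) = v]%classic.
Let prob n i j k := fine (P (at_ n (vertex a i j k))).

Let measurable_at n v : measurable (at_ n v).
Proof.
have -> : at_ n v = (X n @^-1` [set v.1] `&` Y n @^-1` [set v.2])%classic.
  by apply/seteqP; split => w /=; case: v => x y /= [<- <-].
by apply: measurableI; apply: measurable_funPTI; exact: measurable_set1.
Qed.

Let step_mass n i r v : vertices a i v ->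
  fine (P (at_ n.+1 (neighbour a i r v) `&` at_ n v))%classic =
  q i r * fine (P (at_ n v)).
Proof.
(* [hexagonal_step] constrains only vertices of nonzero mass; at a null vertex both sides are 0. *)
move=> vi; have [P0|Pn0] := eqVneq (P (at_ n v)) 0%E.
  rewrite P0 mulr0 (@subset_measure0 _ _ _ P _ (at_ n v)) //.
    exact: measurableI.
rewrite -(hexagonal_step walk (n := n) r vi Pn0) divfK //.
rewrite fine_eq0; first exact: Pn0.
by apply: fin_num_measure; exact: measurable_at.
Qed.

(** Being at [v r] and then at [w] are disjoint events for distinct [r], all contained in being at
    [w]. *)
Let step_ge n i (v : 'I_3 -> R * R) w :
  injective v -> (forall r, vertices a i (v r)) ->
  (forall r, neighbour a i r (v r) = w) ->
  \sum_r q i r * fine (P (at_ n (v r))) <= fine (P (at_ n.+1 w)).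
Proof.
move=> vI vV vN; under eq_bigr do rewrite -step_mass // vN.
apply: sum_fine_probability_le => //.
- by move=> r; exact: measurableI.
- apply/trivIsetP => r s _ _; apply: contra_neq_eq => /set0P[u [[_ ur] [_ us]]].
  by apply: vI; rewrite -ur -us.
Qed.

Let prob_step0 n j k :
  q 0 0 * prob n 0 j k + q 0 1 * prob n 0 (j + 1) (k - 1)
  + q 0 2 * prob n 0 (j + 1) k <= prob n.+1 1 j k.
Proof.
(* Inverting the shift of [neighbour0_vertex] gives the vertex whose [r]-th neighbour is the
   target. *)
pose v (r : 'I_3) := vertex a 0 (j + (r != 0)%:Z) (k - (r == 1)%:Z).
have vI : injective v.
  move=> r s /(vertex_inj (lt0r_neq0 a_gt0)) [/addrI[+] /addrI/oppr_inj[+]].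
  case: r s => -[|[|[|//]]] i [[|[|[|//]]] j'] //= _ _; exact: val_inj.
have := @step_ge n 0 v (vertex a 1 j k) vI.
rewrite sum_ord3 /v /= ?subr0 ?addr0; apply.
- by move=> r; eexists; eexists.
- by move=> r; rewrite neighbour0_vertex addrK subrK.
Qed.

Let prob_step1 n j k :
  q 1 0 * prob n 1 j k + q 1 1 * prob n 1 (j - 1) (k + 1)
  + q 1 2 * prob n 1 (j - 1) k <= prob n.+1 0 j k.
Proof.
pose v (r : 'I_3) := vertex a 1 (j - (r != 0)%:Z) (k + (r == 1)%:Z).
have vI : injective v.
  move=> r s /(vertex_inj (lt0r_neq0 a_gt0)) [/addrI/oppr_inj[+] /addrI[+]].
  case: r s => -[|[|[|//]]] i [[|[|[|//]]] j'] //= _ _; exact: val_inj.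
have := @step_ge n 1 v (vertex a 0 j k) vI.
rewrite sum_ord3 /v /= ?subr0 ?addr0; apply.
- by move=> r; eexists; eexists.
- by move=> r; rewrite neighbour1_vertex addrK subrK.
Qed.

Let gen m n := up_gen q ^+ m * down_gen q ^+ n.

Let prob_ge0 n i j k : 0 <= prob n i j k.
Proof. by rewrite fine_ge0. Qed.

(** The initial condition holds off a null set, whose complement has mass 1. *)
Let prob_init : 1 <= prob 0 0 0 0.
Proof.
have v0 : vertex a 0 0 0 = 0 by rewrite /vertex !mulr0 mul0r !addr0.
have [N [mN PN0 sN]] := hexagonal_init walk.
have PNC : P (~` N)%classic = 1%E by rewrite probability_setC // PN0 sube0.
rewrite /prob v0 -lee_fin fineK; last by apply: fin_num_measure; exact: measurable_at.
rewrite -PNC le_measure ?inE //; first exact: measurableC.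
by move=> w Nw; apply: contrapT => w0; apply: Nw; exact: sN.
Qed.

Let coef_le_prob m :
  (forall J K, (gen m m)`_J`_K <= prob (2 * m) 0 (J%:Z - m%:Z) (K%:Z - m%:Z)).
Proof.
elim: m => [|m IH] J K.
  rewrite /gen !expr0 mulr1 muln0 !subr0 coef1.
  case: J => [|J] /=; last by rewrite coef0.
  by rewrite coef1; case: K => [|K] //=; rewrite prob_init.
(* At the intermediate odd time only the exponent of [j] has received its new shift, hence the
   offsets [m.+1] and [m]. *)
have IH' J' K' : (gen m.+1 m)`_J'`_K' <=
    prob (2 * m).+1 1 (J'%:Z - m.+1%:Z) (K'%:Z - m%:Z).
  apply: le_trans (prob_step0 _ _ _).
  rewrite /gen exprS -mulrA coef_up_gen.
  apply: lerD; first apply: lerD; apply: ler_wpM2l => //.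
  - case: J' => // J'; have := IH J' K'; congr (_ <= prob _ _ _ _); lia.
  - case: K' => // K'; have := IH J' K'; congr (_ <= prob _ _ _ _); lia.
  - have := IH J' K'; congr (_ <= prob _ _ _ _); lia.
rewrite mulnS add2n; apply: le_trans (prob_step1 _ _ _).
rewrite /gen [down_gen q ^+ _]exprS mulrCA coef_down_gen.
apply: lerD; first apply: lerD; apply: ler_wpM2l => //.
- case: K => // K; have := IH' J K; congr (_ <= prob _ _ _ _); lia.
- case: J => // J; have := IH' J K; congr (_ <= prob _ _ _ _); lia.
- case: J K => // J [//|K]; have := IH' J K; congr (_ <= prob _ _ _ _); lia.
Qed.

(** Both one-step polynomials take the value 1 at (1, 1), because each row of [q] sums to 1. *)
Let gen_at1 m n : (gen m n).[1].[1] = 1.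
Proof.
have := q_sum1 0; have := q_sum1 1; rewrite !sum_ord3 => d1 u1.
have up1 : (up_gen q).[1].[1] = 1.
  rewrite -[RHS]u1 /up_gen !(hornerD, hornerM, hornerZ, hornerC, hornerX); ring.
have down1 : (down_gen q).[1].[1] = 1.
  rewrite -[RHS]d1 /down_gen !(hornerD, hornerM, hornerZ, hornerC, hornerX); ring.
by rewrite /gen !(hornerM, horner_exp) up1 down1 !expr1n mulr1.
Qed.

Lemma prob_even m J K :
  fine (P [set w | (X (2 * m)%N w, Y (2 * m)%N w) =
    vertex a 0 (J%:Z - m%:Z) (K%:Z - m%:Z)]%classic) =
  (up_gen q ^+ m * down_gen q ^+ m)`_J`_K.
Proof.
rewrite -/(gen m m) -/(at_ _ _) -/(prob (2 * m) 0 (J%:Z - m%:Z) (K%:Z - m%:Z)).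
pose G := gen m m.
(* [N] bounds the degrees in both variables, so the grid carries all coefficients, and it exceeds
   [J] and [K], so the grid contains the required vertex. *)
pose N := (size G + \sum_(j < size G) size (G`_j)%R + J.+1 + K.+1)%N.
have sG : (size G <= N)%N by rewrite /N; lia.
have sGJ j : (size (G`_j)%R <= N)%N.
  have [lt|/(nth_default 0) ->] := ltnP j (size G); last by rewrite size_poly0.
  rewrite /N (bigD1 (Ordinal lt)) //=; lia.
have ltJ : (J < N)%N by rewrite /N; lia.
have ltK : (K < N)%N by rewrite /N; lia.
pose E (p : 'I_N * 'I_N) := at_ (2 * m) (vertex a 0 (p.1%:Z - m%:Z) (p.2%:Z - m%:Z)).
have tE : trivIset setT E.
  apply/trivIsetP => -[j k] [j' k'] _ _; apply: contra_neq_eq => /set0P[u []].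
  rewrite /E /at_ /= => -> /(vertex_inj (lt0r_neq0 a_gt0)) [ej ek].
  by congr (_, _); apply: val_inj => /=; lia.
have := @sum_fine_probability_le R d T P _ E setT
  (fun _ => measurable_at _ _) measurableT (fun _ => @subsetT _ _) tE.
rewrite probability_setT /= -[X in _ <= X](gen_at1 m m) -(sum_coef_horner sG sGJ).
rewrite pair_bigA /= -subr_ge0 -sumrB => leS.
(* The events on the grid have total mass at most 1 and the coefficients sum to exactly 1.
   Nonnegative differences with nonpositive sum all vanish. *)
pose D (p : 'I_N * 'I_N) := fine (P (E p)) - G`_p.1`_p.2.
have D0 p : 0 <= D p by rewrite subr_ge0 coef_le_prob.
have S0 : \sum_p D p = 0.
  apply/eqP; rewrite eq_le sumr_ge0 // andbT -oppr_ge0 -sumrN.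
  by under eq_bigr do rewrite opprB.
have := psumr_eq0P (fun p _ => D0 p) S0 (i := (Ordinal ltJ, Ordinal ltK)) isT.
by move/eqP; rewrite subr_eq0 => /eqP.
Qed.

End walk_distribution.

(** * Closed forms of the coefficients, by the signs of [j] and [k] *)

Lemma sum_nat_drop (V : nmodType) (f : nat -> V) k B :
  (forall t, (t < k)%N -> f t = 0) ->
  \sum_(0 <= t < B) f t = \sum_(k <= t < B) f t.
Proof.
move=> f0; have f0' b : (b <= k)%N -> \sum_(0 <= t < b) f t = 0.
  move=> lebk; apply: big1_seq => t; rewrite mem_index_iota.
  by move=> /andP[_ /andP[_ lt]]; exact/f0/(leq_trans lt).
have [lekB|ltBk] := leqP k B; last by rewrite f0' 1?ltnW // big_geq // ltnW.
by rewrite [LHS](@big_cat_nat _ _ _ k) //= f0' // add0r.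
Qed.

Section coefficients.
Context {R : realType}.
Variable q : 'I_2 -> 'I_3 -> R.
Hypotheses (q02_neq0 : q 0 2 != 0) (q12_neq0 : q 1 2 != 0).

Let rho := q 0 1 * q 1 1 / (q 0 2 * q 1 2).

(** Closed form of the coefficient of [inner m s t] at degree [m + k]; [inner_neg] is its
    counterpart at degree [m - k]. *)
Definition inner_pos s t k : R :=
  'C(t, k)%:R * q 0 2 ^+ (t - k) * q 0 1 ^+ k * q 1 2 ^+ s *
  hyp2F1 (- (t - k)%:R) (- s%:R) (1 + k%:R) rho.

Definition inner_neg s t k : R :=
  'C(s, k)%:R * q 1 2 ^+ (s - k) * q 1 1 ^+ k * q 0 2 ^+ t *
  hyp2F1 (- (s - k)%:R) (- t%:R) (1 + k%:R) rho.

(** The polynomial in the inner variable left in one term of the outer expansion; ['X^(m - s)] comes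
    from the power of [q 1 0 *: 'X]. *)
Let inner m s t : {poly R} := 'X^(m - s) *
  ((q 1 2 *: 'X + (q 1 1)%:P) ^+ s * ((q 0 2)%:P + q 0 1 *: 'X) ^+ t).

Let inner_posE m s t k : (s <= m)%N ->
  (inner m s t)`_(m + k) = inner_pos s t k.
Proof.
move=> lesm; rewrite coefXnM ifF; last by lia.
have -> : (m + k - (m - s) = s + k)%N by lia.
rewrite (@coef_linear_powers_ge _ _ _ _ _ _ _ _ s.+1) /inner_pos; last by right.
have [lekt|ltkt] := leqP k t; last first.
  rewrite bin_small // !mul0r big1 // => i _.
  by rewrite (@bin_small t) ?mulr0 ?mul0r //; lia.
have -> : rho = q 1 1 * q 0 1 / (q 0 2 * q 1 2) by rewrite /rho mulrC [_ * q 1 1]mulrC mulrC.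
rewrite -sum_bin_hyp2F1 //; apply: eq_bigr => i _; ring.
Qed.

Let inner_negE m s t k : (s <= m)%N -> (k <= m)%N ->
  (inner m s t)`_(m - k) = inner_neg s t k.
Proof.
move=> lesm lekm; rewrite coefXnM /inner_neg.
(* For [s < k] the degree [m - k] lies below the factor ['X^(m - s)], and the binomial is 0 too. *)
have [ltsk|leks] := ltnP s k.
  by rewrite ifT ?bin_small ?mul0r //; lia.
rewrite ifF; last by lia.
have -> : (m - k - (m - s) = s - k)%N by lia.
rewrite (@coef_linear_powers_le _ _ _ _ _ _ _ _ t.+1) //; last by right.
have -> : rho = q 0 1 * q 1 1 / (q 1 2 * q 0 2) by rewrite /rho [q 1 2 * _]mulrC.
by rewrite -sum_bin_hyp2F1.
Qed.

Let genE m : up_gen q ^+ m * down_gen q ^+ m =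
  ((q 0 0)%:P *: 'X + ((q 0 2)%:P + q 0 1 *: 'X)%:P) ^+ m *
  ((q 1 0 *: 'X)%:P + (q 1 2 *: 'X + (q 1 1)%:P) *: 'X) ^+ m.
Proof. by []. Qed.

Let outerE m s t K (c1 c2 : nat) (i : nat) :
  (c1%:R * c2%:R * (q 0 0)%:P ^+ i * ((q 0 2)%:P + q 0 1 *: 'X) ^+ t *
   (q 1 0 *: 'X) ^+ (m - s) * (q 1 2 *: 'X + (q 1 1)%:P) ^+ s : {poly R})`_K =
  c1%:R * c2%:R * q 0 0 ^+ i * q 1 0 ^+ (m - s) * (inner m s t)`_K.
Proof.
rewrite /inner -coefCM; congr (nth _ (polyseq _) _).
rewrite !polyCM !polyC_natr !polyC_exp exprZn -!mul_polyC ?polyC_exp; ring.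
Qed.

(** Expansion in the outer variable alone; the coefficients of the linear factors are still
    polynomials in the inner one. *)
Lemma coef_gen_pos m j K B : (m < j + B)%N ->
  (up_gen q ^+ m * down_gen q ^+ m)`_(m + j)`_K =
  \sum_(0 <= t < B) 'C(m, t)%:R * 'C(m, j + t)%:R * q 0 0 ^+ (m - t) *
    q 1 0 ^+ (m - (j + t)) * (inner m (j + t) t)`_K.
Proof.
move=> ltB; rewrite genE (@coef_linear_powers_ge _ _ _ _ _ _ _ _ B); last by left.
by rewrite coef_sum; apply: eq_bigr => t _; exact: outerE.
Qed.

Lemma coef_gen_neg m j K B : (j <= m)%N -> (m < j + B)%N ->
  (up_gen q ^+ m * down_gen q ^+ m)`_(m - j)`_K =
  \sum_(0 <= t < B) 'C(m, j + t)%:R * 'C(m, t)%:R * q 0 0 ^+ (m - (j + t)) *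
    q 1 0 ^+ (m - t) * (inner m t (j + t))`_K.
Proof.
move=> lejm ltB; rewrite genE (@coef_linear_powers_le _ _ _ _ _ _ _ _ B) //; last by left.
by rewrite coef_sum; apply: eq_bigr => t _; exact: outerE.
Qed.

Lemma coef_pos_neg m j k : (j <= m)%N -> (k <= m)%N ->
  (up_gen q ^+ m * down_gen q ^+ m)`_(m + j)`_(m - k) =
  \sum_(0 <= t < (m - j).+1) 'C(m, t)%:R * 'C(m, j + t)%:R *
    q 0 0 ^+ (m - t) * q 1 0 ^+ (m - (j + t)) * inner_neg (j + t) t k.
Proof.
move=> lej lek; rewrite (@coef_gen_pos _ _ _ (m - j).+1); last by lia.
by apply: eq_big_nat => t lt; rewrite inner_negE //; lia.
Qed.

Lemma coef_pos_pos m j k : (j <= m)%N ->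
  (up_gen q ^+ m * down_gen q ^+ m)`_(m + j)`_(m + k) =
  \sum_(k <= t < (m - j).+1) 'C(m, t)%:R * 'C(m, j + t)%:R *
    q 0 0 ^+ (m - t) * q 1 0 ^+ (m - (j + t)) * inner_pos (j + t) t k.
Proof.
move=> lej; rewrite -sum_nat_drop => [|t ltk]; last first.
  by rewrite /inner_pos (bin_small ltk) !(mul0r, mulr0).
rewrite (@coef_gen_pos _ _ _ (m - j).+1); last by lia.
by apply: eq_big_nat => t lt; rewrite inner_posE //; lia.
Qed.

Lemma coef_neg_neg m j k : (j <= m)%N -> (k <= m)%N ->
  (up_gen q ^+ m * down_gen q ^+ m)`_(m - j)`_(m - k) =
  \sum_(k <= t < (m - j).+1) 'C(m, j + t)%:R * 'C(m, t)%:R *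
    q 0 0 ^+ (m - (j + t)) * q 1 0 ^+ (m - t) * inner_neg t (j + t) k.
Proof.
move=> lej lek; rewrite -sum_nat_drop => [|t ltk]; last first.
  by rewrite /inner_neg (bin_small ltk) !(mul0r, mulr0).
rewrite (@coef_gen_neg _ _ _ (m - j).+1) //; last by lia.
by apply: eq_big_nat => t lt; rewrite inner_negE //; lia.
Qed.

Lemma coef_neg_pos m j k : (j <= m)%N ->
  (up_gen q ^+ m * down_gen q ^+ m)`_(m - j)`_(m + k) =
  \sum_(0 <= t < (m - j).+1) 'C(m, j + t)%:R * 'C(m, t)%:R *
    q 0 0 ^+ (m - (j + t)) * q 1 0 ^+ (m - t) * inner_pos t (j + t) k.
Proof.
move=> lej; rewrite (@coef_gen_neg _ _ _ (m - j).+1) //; last by lia.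
by apply: eq_big_nat => t lt; rewrite inner_posE //; lia.
Qed.

End coefficients.

(** * Passage to integer indices and the four cases *)

(** Cases (ii) and (iii) list the upper parameters in the opposite order to [inner_pos] and
    [inner_neg]. *)
Lemma hyp2F1C (R : realType) (x y c z : R) : hyp2F1 x y c z = hyp2F1 y x c z.
Proof.
rewrite /hyp2F1; congr (limn (series _)); apply/funext => n.
by rewrite [pochhammer x n * _]mulrC.
Qed.

Theorem proposition3p2 (R : realType) (d : measure_display)
    (T : measurableType d) (P : probability T R)
    (a : R) (q : 'I_2 -> 'I_3 -> R) (X Y : nat -> {RV P >-> R})
    (a_gt0 : 0 < a)
    (q_ge0 : forall i r, 0 <= q i r)
    (q_sum1 : forall i, \sum_(r < 3) q i r = 1)
    (walk : hexagonal_walk a q X Y)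
    (q02_neq0 : q 0 2 != 0) (q12_neq0 : q 1 2 != 0)
    (m : nat) (m_gt0 : (0 < m)%N) :
  let rho := q 0 1 * q 1 1 / (q 0 2 * q 1 2) in
  let p := state_prob a X Y in
  let M := m%:Z in
  [/\ forall j k : int, 0 <= j <= M -> - M <= k <= 0 ->
        p j k (2 * m)%N =
        \sum_(0 <= t < `|M - j|.+1)
          let t := t%:Z in
          binz M t * binz M (j + t) * binz (j + t) (- k) *
          q 0 0 ^ (M - t) * q 1 0 ^ (M - j - t) *
          q 0 2 ^ t * q 1 2 ^ (j + k + t) * q 1 1 ^ (- k) *
          hyp2F1 (- j - k - t)%:~R (- t)%:~R (1 - k)%:~R rho,
      forall j k : int, 0 <= j <= M -> 1 <= k <= M - j ->
        p j k (2 * m)%N =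
        \sum_(`|k| <= t < `|M - j|.+1)
          let t := t%:Z in
          binz M t * binz M (j + t) * binz t k *
          q 0 0 ^ (M - t) * q 1 0 ^ (M - j - t) *
          q 0 1 ^ k * q 0 2 ^ (- k + t) * q 1 2 ^ (j + t) *
          hyp2F1 (- j - t)%:~R (k - t)%:~R (1 + k)%:~R rho,
      forall j k : int, - M <= j <= -1 -> - M - j <= k <= -1 ->
        p j k (2 * m)%N =
        \sum_(`|k| <= t < `|M + j|.+1)
          let t := t%:Z in
          binz M t * binz M (- j + t) * binz t (- k) *
          q 0 0 ^ (M + j - t) * q 1 0 ^ (M - t) *
          q 0 2 ^ (- j + t) * q 1 2 ^ (k + t) * q 1 1 ^ (- k) *
          hyp2F1 (j - t)%:~R (- k - t)%:~R (1 - k)%:~R rho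
    & forall j k : int, - M <= j <= -1 -> 0 <= k <= M ->
        p j k (2 * m)%N =
        \sum_(0 <= t < `|M + j|.+1)
          let t := t%:Z in
          binz M t * binz M (- j + t) * binz (- j + t) k *
          q 0 0 ^ (M + j - t) * q 1 0 ^ (M - t) *
          q 0 1 ^ k * q 0 2 ^ (- j - k + t) * q 1 2 ^ t *
          hyp2F1 (j + k - t)%:~R (- t)%:~R (1 + k)%:~R rho].
Proof.
move=> rho p M.
(* At an even time [i_n] is 0, so [state_prob] looks at vertices with [i = 0], as [prob_even]
   does. *)
have pE J K j k : j = J%:Z - m%:Z -> k = K%:Z - m%:Z -> p j k (2 * m)%N =
    (up_gen q ^+ m * down_gen q ^+ m)`_J`_K.
  move=> -> ->; rewrite -(prob_even a_gt0 q_ge0 q_sum1 walk) /p /state_prob.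
  by rewrite exprM sqrrN !expr1n subrr mul0r.
have exprz_nat (x : R) (z : int) n : z = n%:Z -> x ^ z = x ^+ n by move=> ->.
have binz_nat (x y : int) u v : x = u%:Z -> y = v%:Z -> binz x y = 'C(u, v)%:R :> R.
  by move=> -> ->.
have hypE (x y z : int) u v w : x = - u%:Z -> y = - v%:Z -> z = 1 + w%:Z ->
    hyp2F1 x%:~R y%:~R z%:~R rho =
    hyp2F1 (- u%:R) (- v%:R) (1 + w%:R) rho.
  by move=> -> -> ->; rewrite !mulrNz mulrzDr.
split=> j k.
- case: j => [j|//] /andP[_]; rewrite /M => lej /andP[gek lek].
  have {}lej : (j <= m)%N by lia.
  have [k' ek lek'] : exists2 k', k = - k'%:Z & (k' <= m)%N by exists `|k|%N; lia.
  rewrite (@pE (m + j)%N (m - k')%N); [|lia|lia].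
  rewrite coef_pos_neg //.
  have -> : `|m%:Z - j%:Z|%N = (m - j)%N by lia.
  apply: eq_big_nat => t /andP[_ ltt]; rewrite /inner_neg.
  rewrite (@binz_nat _ _ m t) // (@binz_nat _ _ m (j + t)%N) //.
  rewrite (@binz_nat _ _ (j + t)%N k') //; last by lia.
  (* For [k' > j + t] the integer exponent of [q 1 2] is negative and denotes an inverse power, but
     the binomial factor is 0 on both sides. *)
  have [lekjt|gtk] := leqP k' (j + t); last by rewrite (bin_small gtk) !(mulr0, mul0r).
  rewrite (@exprz_nat _ _ (m - t)%N); last by lia.
  rewrite (@exprz_nat _ _ (m - (j + t))%N); last by lia.
  rewrite (@exprz_nat _ _ t) //.
  rewrite (@exprz_nat _ _ (j + t - k')%N); last by lia.
  rewrite (@exprz_nat _ _ k'); last by lia.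
  rewrite (@hypE _ _ _ (j + t - k')%N t k'); [rewrite -/rho; ring|lia|by []|lia].
- case: j => [j|//] /andP[_]; rewrite /M => lej /andP[gek lek].
  case: k gek lek => [k|//] gek lek.
  have {}lej : (j <= m)%N by lia.
  rewrite (@pE (m + j)%N (m + k)%N); [|lia|lia].
  rewrite coef_pos_pos //.
  have -> : `|m%:Z - j%:Z|%N = (m - j)%N by lia.
  apply: eq_big_nat => t /andP[lekt ltt]; rewrite /inner_pos.
  have {}lekt : (k <= t)%N by [].
  rewrite (@binz_nat _ _ m t) // (@binz_nat _ _ m (j + t)%N) //.
  rewrite (@binz_nat _ _ t k) //.
  rewrite (@exprz_nat _ _ (m - t)%N); last by lia.
  rewrite (@exprz_nat _ _ (m - (j + t))%N); last by lia.
  rewrite (@exprz_nat _ _ k) //.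
  (* The sum starts at [k], so this exponent is nonnegative. *)
  rewrite (@exprz_nat _ _ (t - k)%N); last by lia.
  rewrite (@exprz_nat _ _ (j + t)%N) //.
  rewrite (@hypE _ _ _ (j + t)%N (t - k)%N k); [rewrite hyp2F1C -/rho; ring|lia|lia|by []].
- rewrite /M => /andP[gej lej] /andP[gek lek].
  have [j' ej lej'] : exists2 j', j = - j'%:Z & (j' <= m)%N by exists `|j|%N; lia.
  have [k' ek lek'] : exists2 k', k = - k'%:Z & (k' <= m)%N by exists `|k|%N; lia.
  rewrite (@pE (m - j')%N (m - k')%N); [|lia|lia].
  rewrite coef_neg_neg //.
  have -> : absz (m%:Z + j) = (m - j')%N by lia.
  have -> : absz k = k' by lia.
  apply: eq_big_nat => t /andP[lekt ltt]; rewrite /inner_neg.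
  rewrite (@binz_nat _ _ m t) // (@binz_nat _ _ m (j' + t)%N) //; last by lia.
  rewrite (@binz_nat _ _ t k') //; last by lia.
  rewrite (@exprz_nat _ _ (m - (j' + t))%N); last by lia.
  rewrite (@exprz_nat _ _ (m - t)%N); last by lia.
  rewrite (@exprz_nat _ _ (j' + t)%N); last by lia.
  rewrite (@exprz_nat _ _ (t - k')%N); last by lia.
  rewrite (@exprz_nat _ _ k'); last by lia.
  rewrite (@hypE _ _ _ (j' + t)%N (t - k')%N k'); [rewrite hyp2F1C -/rho; ring|lia|lia|lia].
- rewrite /M => /andP[gej lej] /andP[gek lek].
  case: k gek lek => [k|//] gek lek.
  have [j' ej lej'] : exists2 j', j = - j'%:Z & (j' <= m)%N by exists `|j|%N; lia.
  rewrite (@pE (m - j')%N (m + k)%N); [|lia|lia].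
  rewrite coef_neg_pos //.
  have -> : absz (m%:Z + j) = (m - j')%N by lia.
  apply: eq_big_nat => t /andP[_ ltt]; rewrite /inner_pos.
  rewrite (@binz_nat _ _ m t) // (@binz_nat _ _ m (j' + t)%N) //; last by lia.
  rewrite (@binz_nat _ _ (j' + t)%N k) //; last by lia.
  (* As in case (i), a negative exponent, here of [q 0 2], occurs only beside a zero binomial. *)
  have [lekjt|gtk] := leqP k (j' + t); last by rewrite (bin_small gtk) !(mulr0, mul0r).
  rewrite (@exprz_nat _ _ (m - (j' + t))%N); last by lia.
  rewrite (@exprz_nat _ _ (m - t)%N); last by lia.
  rewrite (@exprz_nat _ _ k) //.
  rewrite (@exprz_nat _ _ (j' + t - k)%N); last by lia.
  rewrite (@exprz_nat _ _ t) //.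
  rewrite (@hypE _ _ _ (j' + t - k)%N t k); [rewrite -/rho; ring|lia|by []|by []].
Qed.
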